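(* For all integers $1\le n\le k$ and $m\ge1$, $$d^*(2m,k,n)\le 2\,d^*(m,k,n).$$
   Context: For $1\le j\le k$ let $Q_j=\prod_{I\subseteq\{1,\ldots,k\},\,|I|=j}\bigl(\sum_{i\in I}a_i\bigr)\in\mathbb{F}_2[a_1,\ldots,a_k]$, and $P_{k,n}=Q_1Q_2\cdots Q_n$. Put $\mathcal{R}_{d,k}=\mathbb{F}_2[a_1,\ldots,a_k]/(a_1^{d+1},a_2^{d},\ldots,a_k^{d-k+2})$ (the $i$-th generator is $a_i^{d-i+2}$; the ring is taken to be zero if some exponent is $\le0$). $d^*(m,k,n)$ denotes the minimal integer $d\ge0$ such that $(P_{k,n})^m\neq0$ in $\mathcal{R}_{d,k}$. *)

(* Defs.v *)
From HB Require Import structures.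
From mathcomp Require Import all_boot all_order all_algebra generic_quotient ring_quotient.
From mathcomp Require Import boolp zify mpoly.

Set Implicit Arguments.
Unset Strict Implicit.
Unset Printing Implicit Defensive.

Import GRing.Theory.
Local Open Scope ring_scope.
Local Open Scope quotient_scope.

(* The library gives {ideal_quot I} a ring structure only when I is proper.  The
   ideals needed here may be the whole ring, so {ideal_quot I}, as an additive
   group, is equipped below with a possibly trivial comPzRingType structure. *)
Section QuotientByGenerators.
Variables (A : comNzRingType) (k : nat) (g : 'I_k -> A).

Definition gen_ideal : {pred A} :=
  fun p => `[< exists c : 'I_k -> A, p = \sum_i c i * g i >].

Lemma gen_idealP p :
  reflect (exists c : 'I_k -> A, p = \sum_i c i * g i) (p \in gen_ideal).
Proof. exact: asboolP. Qed.

Lemma gen_ideal_zmod_closed : zmod_closed gen_ideal.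
Proof.
split=> [|p q /gen_idealP[c ->] /gen_idealP[d ->]]; apply/gen_idealP.
  by exists (fun=> 0); rewrite big1 // => i _; rewrite mul0r.
exists (fun i => c i - d i); rewrite -sumrB.
by apply: eq_bigr => i _; rewrite mulrBl.
Qed.

HB.instance Definition _ :=
  GRing.isZmodClosed.Build A gen_ideal gen_ideal_zmod_closed.

Lemma gen_idealMl p q : q \in gen_ideal -> p * q \in gen_ideal.
Proof.
move=> /gen_idealP[c ->]; apply/gen_idealP; exists (fun i => p * c i).
by rewrite mulr_sumr; apply: eq_bigr => i _; rewrite mulrA.
Qed.

Lemma mem_gen_ideal i : g i \in gen_ideal.
Proof.
apply/gen_idealP; exists (fun j => (j == i)%:R).
rewrite (bigD1 i) //= eqxx mul1r big1 ?addr0 // => j /negbTE ->.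
by rewrite mul0r.
Qed.

Definition gen_quot := {ideal_quot gen_ideal}.

HB.instance Definition _ := GRing.Zmodule.on gen_quot.
HB.instance Definition _ := EqQuotient.on gen_quot.

Definition gen_quot_one : gen_quot := \pi_gen_quot 1.
Definition gen_quot_mul (x y : gen_quot) : gen_quot :=
  \pi_gen_quot (repr x * repr y).

Lemma pi_gen_quot_eq p q :
  (\pi_gen_quot p == \pi_gen_quot q) = (p - q \in gen_ideal).
Proof. by rewrite -Quotient.idealrBE. Qed.

Lemma pi_gen_quotM p q :
  gen_quot_mul (\pi_gen_quot p) (\pi_gen_quot q) = \pi_gen_quot (p * q).
Proof.
have E r : repr (\pi_gen_quot r) - r \in gen_ideal.
  by rewrite -pi_gen_quot_eq reprK.
apply/eqP; rewrite /gen_quot_mul pi_gen_quot_eq.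
set p' := repr _; set q' := repr _.
have -> : p' * q' - p * q = p' * (q' - q) + q * (p' - p).
  by rewrite !mulrBr addrA [q * p']mulrC subrK [q * p]mulrC.
by apply: rpredD; apply: gen_idealMl; apply: E.
Qed.

Lemma pi_gen_quotD p q :
  \pi_gen_quot p + \pi_gen_quot q = \pi_gen_quot (p + q).
Proof. by rewrite [RHS](Quotient.pi_add (gen_ideal : zmodClosed A)). Qed.

Lemma gen_quot_surj (x : gen_quot) : exists p, x = \pi_gen_quot p.
Proof. by exists (repr x); rewrite reprK. Qed.

Lemma gen_quot_mulA : associative gen_quot_mul.
Proof.
move=> x y z; have [p ->] := gen_quot_surj x.
have [[q ->] [r ->]] := (gen_quot_surj y, gen_quot_surj z).
by rewrite !pi_gen_quotM mulrA.
Qed.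

Lemma gen_quot_mulC : commutative gen_quot_mul.
Proof. by move=> x y; rewrite /gen_quot_mul mulrC. Qed.

Lemma gen_quot_mul1 : left_id gen_quot_one gen_quot_mul.
Proof.
by move=> x; have [p ->] := gen_quot_surj x; rewrite pi_gen_quotM mul1r.
Qed.

Lemma gen_quot_mulD : left_distributive gen_quot_mul +%R.
Proof.
move=> x y z; have [p ->] := gen_quot_surj x.
have [[q ->] [r ->]] := (gen_quot_surj y, gen_quot_surj z).
by rewrite pi_gen_quotD !pi_gen_quotM pi_gen_quotD mulrDl.
Qed.

HB.instance Definition _ := GRing.Zmodule_isComPzRing.Build gen_quot
  gen_quot_mulA gen_quot_mulC gen_quot_mul1 gen_quot_mulD.

Definition to_gen_quot (p : A) : gen_quot := \pi_gen_quot p.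

Lemma to_gen_quot_zmod : zmod_morphism to_gen_quot.
Proof.
move=> p q; apply: (addIr (to_gen_quot q)).
by rewrite [LHS]pi_gen_quotD !subrK.
Qed.

Lemma to_gen_quot_monoid : monoid_morphism to_gen_quot.
Proof. by split=> // p q; rewrite /to_gen_quot -pi_gen_quotM. Qed.

HB.instance Definition _ :=
  GRing.isZmodMorphism.Build A gen_quot to_gen_quot to_gen_quot_zmod.
HB.instance Definition _ :=
  GRing.isMonoidMorphism.Build A gen_quot to_gen_quot to_gen_quot_monoid.

Lemma to_gen_quot_eq0 p : (to_gen_quot p == 0) = (p \in gen_ideal).
Proof. by rewrite -(rmorph0 to_gen_quot) pi_gen_quot_eq subr0. Qed.

End QuotientByGenerators.

Definition Q (k j : nat) : {mpoly 'F_2[k]} :=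
  \prod_(I : {set 'I_k} | #|I| == j) \sum_(i in I) 'X_i.

Definition P (k n : nat) : {mpoly 'F_2[k]} := \prod_(1 <= j < n.+1) Q k j.

(* Variables are numbered from 0: 'X_i stands for a_(i + 1), whose exponent
   d - (i + 1) + 2 is d.+1 - i.  Where that is negative, the truncated
   subtraction gives 0, hence the generator 1 and the zero ring (Rd_trivial). *)
Definition Rd_gen (d k : nat) (i : 'I_k) : {mpoly 'F_2[k]} :=
  'X_i ^+ (d.+1 - i).
Arguments Rd_gen : clear implicits.

Definition Rd (d k : nat) : comPzRingType := gen_quot (Rd_gen d k).

Definition to_Rd (d k : nat) : {rmorphism {mpoly 'F_2[k]} -> Rd d k} :=
  to_gen_quot (Rd_gen d k).

Lemma Rd_trivial d k (i : 'I_k) : (d.+1 <= i)%N -> (1 : Rd d k) = 0.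
Proof.
move=> le_di; rewrite -(rmorph1 (to_Rd d k)); apply/eqP.
rewrite to_gen_quot_eq0; have := mem_gen_ideal (Rd_gen d k) i.
by rewrite /Rd_gen (eqP le_di) expr0.
Qed.

Lemma P_neq0 k n : P k n != 0.
Proof.
rewrite /P big_nat prodf_seq_neq0; apply/allP => j _; apply/implyP.
case/andP=> j_gt0 _; apply/prodf_neq0 => I /eqP cardI.
have /card_gt0P[i iI] : (0 < #|I|)%N by rewrite cardI.
apply/eqP => /(congr1 (mcoeff U_(i)%MM)); apply/eqP.
rewrite raddf_sum (bigD1 i) //= big1 => [|j' /andP[_ /negbTE ne]].
  by rewrite mcoeffXU eqxx addr0 mcoeff0 oner_eq0.
by rewrite mcoeffXU ne.
Qed.

Lemma to_Rd_neq0 k (p : {mpoly 'F_2[k]}) :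
  p != 0 -> to_Rd (k + msize p) k p != 0.
Proof.
move=> p_neq0; rewrite to_gen_quot_eq0; apply/negP => /gen_idealP[c].
move=> /(congr1 (mcoeff (mlead p))); apply/eqP.
rewrite raddf_sum big1 ?mleadc_eq0 // => i _.
apply/eqP; rewrite -[_ == _]negbK -mcoeff_msupp /Rd_gen mpolyXn.
rewrite (perm_mem (msuppMX _ _)); apply/negP => /mapP[mm _ E].
have : (mlead p i < msize p)%N.
  apply: leq_ltn_trans (msize_mdeg_lt (mlead_supp p_neq0)).
  by rewrite mdegE (bigD1 i) //= leq_addr.
rewrite E mnmDE mulmnE mnm1E eqxx mul1n.
have := ltn_ord i; lia.
Qed.

Lemma dstar_exists m k n : exists d, to_Rd d k (P k n ^+ m) != 0.
Proof.
exists (k + msize (P k n ^+ m)); apply: to_Rd_neq0.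
exact: expf_neq0 (P_neq0 k n).
Qed.

Definition dstar (m k n : nat) : nat := ex_minn (dstar_exists m k n).

(* Main.v *)
(** Squaring in characteristic 2 doubles the exponents of every monomial.  A
    polynomial is nonzero in R_{d,k} iff it has a monomial a^e with
    e_i <= d - i + 1 for all i, and then 2 e_i <= 2 d - i + 1 because i >= 1. *)
Require Import Defs.
From mathcomp Require Import all_boot.
From mathcomp Require Import all_algebra boolp zify mpoly.

Set Implicit Arguments.
Unset Strict Implicit.
Unset Printing Implicit Defensive.

Import GRing.Theory.

Section Monomials.
Local Open Scope ring_scope.

(** Membership in an ideal generated by monomials can be tested one monomial at a time, so
    cancellation between terms is harmless. *)
Lemma mem_monomial_ideal (R : comNzRingType) n k (u : 'I_k -> 'X_{1..n})
    (p : {mpoly R[n]}) :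
  (p \in gen_ideal (fun i => 'X_[u i] : {mpoly R[n]})) =
  all (fun e => [exists i, (u i <= e)%MM]) (msupp p).
Proof.
apply/idP/allP => [/gen_idealP[c ->] e | div_p].
  (* If no [u i] divides [e], then [e] has coefficient 0 in every [c i * 'X_[u i]], hence in [p]. *)
  apply: contraLR => /existsPn ndiv; rewrite -mcoeff_eq0 raddf_sum big1 // => i _.
  apply/eqP; rewrite mcoeff_eq0 (perm_mem (msuppMX _ _)).
  by apply: contra (ndiv i) => /mapP[e' _ ->]; apply: lem_addr.
rewrite [p]mpolyE big_seq; apply: rpred_sum => e /div_p /existsP[i le_ue].
rewrite -(submK le_ue) mpolyXD scalerAl.
by apply: gen_idealMl; apply: mem_gen_ideal.
Qed.

(** The Frobenius map is additive, so it acts term by term; multiplication by [q] is injective on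
    exponents, so no two resulting terms collide. *)
Lemma mcoeff_pFrobenius (R : comNzRingType) n q (f : {mpoly R[n]}) e :
  q \in [pchar R] -> (f ^+ q)@_(e *+ q) = f@_e ^+ q.
Proof.
move=> charRq; have q_gt0 := prime_gt0 (pcharf_prime charRq).
have charq : q \in [pchar {mpoly R[n]}] by apply: (rmorph_pchar (@mpolyC n R)).
have mulIq : injective (fun e' : 'X_{1..n} => (e' *+ q)%MM).
  move=> e1 e2 /mnmP eq_e; apply/mnmP => i; have := eq_e i.
  by rewrite !mulmnE => /eqP; rewrite eqn_pmul2r // => /eqP.
rewrite [in LHS](mpolyE f) -(pFrobenius_autE charq) rmorph_sum raddf_sum /=.
have coefE e' : (pFrobenius_aut charq (f@_e' *: 'X_[e']))@_(e *+ q) =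
    f@_e' ^+ q * (e' == e)%:R.
  by rewrite pFrobenius_autE exprZn mpolyXn mcoeffZ mcoeffX (inj_eq mulIq).
rewrite (eq_bigr _ (fun e' _ => coefE e')).
have [supp_e | nsupp_e] := boolP (e \in msupp f).
  rewrite (bigD1_seq e) ?msupp_uniq //= eqxx mulr1 big1 ?addr0 // => e' ne.
  by rewrite (negbTE ne) mulr0.
(* Outside the support the right side is [0 ^+ q], which is 0 because [q > 0]. *)
rewrite (memN_msupp_eq0 nsupp_e) expr0n gtn_eqF // big_seq big1 // => e' supp_e'.
have [eq_e | _] := eqVneq e' e; last by rewrite mulr0.
by rewrite -eq_e supp_e' in nsupp_e.
Qed.

(** The strict bound also covers the zero ring: if [d.+1 <= i], truncation makes it [e i < 0], which
    no monomial satisfies. *)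
Lemma to_Rd_neq0P d k (p : {mpoly 'F_2[k]}) :
  reflect (exists2 e, e \in msupp p & forall i : 'I_k, (e i < d.+1 - i)%N)
          (to_Rd d k p != 0).
Proof.
have le1 (i : 'I_k) r (e : 'X_{1..k}) : (U_(i) *+ r <= e)%MM = (r <= e i)%N.
  apply/mnm_lepP/idP => [/(_ i) | le_r j]; rewrite mulmnE mnm1E.
    by rewrite eqxx mul1n.
  by have [<- | _] := eqVneq i j; rewrite ?mul1n ?mul0n.
have -> : (to_Rd d k p != 0) =
    ~~ all (fun e : 'X_{1..k} => [exists i : 'I_k, (d.+1 - i <= e i)%N]) (msupp p).
  rewrite to_gen_quot_eq0.
  have -> : Rd_gen d k = fun i => 'X_[U_(i) *+ (d.+1 - i)].
    by apply: funext => i; rewrite /Rd_gen mpolyXn.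
  by rewrite mem_monomial_ideal; congr (~~ _); apply: eq_all => e;
     apply: eq_existsb => i; rewrite le1.
rewrite -has_predC; apply: (iffP hasP) => -[e supp_e lt_e]; exists e => //=.
  by move=> i; rewrite ltnNge; apply: contra lt_e => le_i; apply/existsP; exists i.
by apply/existsPn => i; rewrite -ltnNge.
Qed.

Lemma to_Rd_sqr_neq0 d k (p : {mpoly 'F_2[k]}) :
  to_Rd d k p != 0 -> to_Rd (2 * d) k (p ^+ 2) != 0.
Proof.
move=> /to_Rd_neq0P[e supp_e lt_e]; apply/to_Rd_neq0P; exists (e *+ 2)%MM.
  by rewrite mcoeff_msupp mcoeff_pFrobenius ?pchar_Fp // expf_neq0 // -mcoeff_msupp.
(* With indices from 0, [e i <= d - i] gives [2 * e i <= 2 * d - 2 * i <= 2 * d - i]. *)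
by move=> i; have := lt_e i; rewrite mulmnE; lia.
Qed.

Lemma dstar_neq0 m k n : to_Rd (dstar m k n) k (P k n ^+ m) != 0.
Proof. by rewrite /dstar; case: ex_minnP. Qed.

Lemma dstar_le m k n d : to_Rd d k (P k n ^+ m) != 0 -> (dstar m k n <= d)%N.
Proof. by rewrite /dstar; case: ex_minnP => d' _; apply. Qed.

End Monomials.

Theorem mainTheorem9 (m k n : nat) (hn : 1 <= n) (hnk : n <= k) (hm : 1 <= m) :
  dstar (2 * m) k n <= 2 * dstar m k n.
Proof.
by apply: dstar_le; rewrite [(2 * m)%N]mulnC exprM to_Rd_sqr_neq0 ?dstar_neq0.
Qed.
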